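(* For all integers $d\ge 3$ and $n\ge d+3$, $$M_d(n)\ \ge\ \binom{n-1}{d}+\binom{n-4}{d-2}+M_{d-3}(n-5).$$
   Context: For a finite set $X$, a family $\mathcal{F}\subseteq 2^X$ and a set $S\subseteq X$, the trace of $\mathcal{F}$ on $S$ is $\operatorname{Tr}_{\mathcal{F}}(S)=\{F\cap S: F\in\mathcal{F}\}$. The set $S$ is shattered by $\mathcal{F}$ if $\operatorname{Tr}_{\mathcal{F}}(S)=2^S$, and the VC-dimension $\operatorname{VC}(\mathcal{F})$ is the maximum size of a set shattered by $\mathcal{F}$. Write $[n]=\{1,\dots,n\}$ and let $\binom{X}{r}$ denote the set of all $r$-element subsets of $X$. For integers $d\ge 0$ and $n\ge d+1$ define $$M_d(n)=\max\left\{|\mathcal{F}| : \mathcal{F}\subseteq\binom{[n]}{d+1},\ \operatorname{VC}(\mathcal{F})\le d\right\}.$$ Convention: the numerical binomial coefficient $\binom{m}{r}$ is $0$ if $r<0$ or $r>m$. *)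

(* Defs.v *)
From mathcomp Require Import all_boot.

Set Implicit Arguments.
Unset Strict Implicit.
Unset Printing Implicit Defensive.

Definition trace (T : finType) (F : {set {set T}}) (S : {set T}) : {set {set T}} :=
  [set A :&: S | A in F].

Definition shattered (T : finType) (F : {set {set T}}) (S : {set T}) : bool :=
  trace F S == powerset S.

(* The empty family shatters no set; as a maximum over the empty range, its
   VC-dimension is 0 here, which does not affect the condition VC(F) <= d. *)
Definition VCdim (T : finType) (F : {set {set T}}) : nat :=
  \max_(S : {set T} | shattered F S) #|S|.

(* The ground set [n] = {1, ..., n} is rendered as 'I_n = {0, ..., n - 1}. *)
Definition M (d n : nat) : nat :=
  \max_(F : {set {set 'I_n}} |
          (F \subset [set A : {set 'I_n} | #|A| == d.+1]) && (VCdim F <= d)) #|F|.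

(* Main.v *)
Require Import Defs.
From mathcomp Require Import all_boot.
From mathcomp Require Import zify.

Set Implicit Arguments.
Unset Strict Implicit.
Unset Printing Implicit Defensive.

(** The family lives on five distinguished points 0, ..., 4 together with
    m = n - 5 outer points, and membership of a (d+1)-set X is decided by its
    pattern, its intersection with the five points, and for one pattern also by
    its outer part.

    The starting point is the Ahlswede-Khachatryan family of k-sets, of size
    C(N-1, k-1) + C(N-4, k-3) on N points.  Pick four points forming a path
    a - b - c - d, and let X in if it meets the four points in {b}, in an edge
    of the path, or in at least three points.  Here this is used twice: for the
    sets avoiding 4, with the path 0 - 1 - 2 - 3, and for the sets containing 4
    (which are (k-1)-sets on the remaining N = n - 1 points), with the rotated
    path 1 - 2 - 3 - 0.  By Pascal's rule the sizes add up to
    C(n-1, d) + C(n-4, d-2).  The eighteen admissible patterns form [core].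
    Rotating the path leaves room for one more kind of set: {1, 3, 4}
    together with a member of an extremal family H for M (d-3) (n-5).

    Say that B is missed on S if no member X of the family has X :&: S = B.
    A set S of pattern t and outer part C has a missed subset for one of two
    reasons ([core_missed]):
    - B consists of all of C and of some u included in t.  A member meeting S
      in B contains C, so its pattern has at most #|t| points; hence B is missed
      as soon as no pattern of size at most #|t| meets t in u.
    - B consists of u included in t and of some D included in C that H misses
      on C, where no core pattern at all meets t in u.  A member meeting S in B
      would have to be one of the sets {1, 3, 4} with outer part in H, and H
      would realize D.  This needs #|C| = d - 2, that is #|t| = 3, for D to
      exist.  Only t = {0, 2, 3} uses this, with u = {3}, which the extra
      pattern {1, 3, 4} does cut out.

    That each pattern falls under one of the two cases is a finite check. *)

(** * Shattering and uniform families *)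

Lemma shatteredP (T : finType) (F : {set {set T}}) (S : {set T}) :
  reflect (forall B : {set T}, B \subset S -> exists2 A, A \in F & A :&: S = B)
          (shattered F S).
Proof.
apply: (iffP eqP) => [FS B BS | FS].
  have /imsetP[A AF ->] : B \in trace F S by rewrite FS powersetE.
  by exists A.
apply/setP=> B; rewrite powersetE; apply/imsetP/idP => [[A _ ->] | /FS[A AF <-]].
  exact: subsetIr.
by exists A.
Qed.

Lemma missed_trace (T : finType) (F : {set {set T}}) (S : {set T}) d :
  VCdim F <= d -> d < #|S| ->
  exists2 B : {set T}, B \subset S & forall A, A \in F -> A :&: S <> B.
Proof.
move=> VCF dS.
have /existsP[B /andP[BS /'forall_implyP FB]] :
    [exists B : {set T}, (B \subset S) && [forall A in F, A :&: S != B]].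
  apply: contraLR dS; rewrite negb_exists -leqNgt => /forallP noB.
  apply: leq_trans VCF; apply: (bigmax_sup S) => //; apply/shatteredP=> B BS; have := noB B.
  by rewrite BS /= => /forall_inPn[A AF /negPn/eqP]; exists A.
by exists B => // A /FB/eqP.
Qed.

(** In a (d+1)-uniform family a shattered set with more than d points is itself
    a member, since it is contained in one. *)
Lemma VCdim_uniform (T : finType) (F : {set {set T}}) d :
    (forall A, A \in F -> #|A| = d.+1) ->
    (forall S, S \in F -> ~~ shattered F S) ->
  VCdim F <= d.
Proof.
move=> Fd Fns; apply/bigmax_leqP=> S FS; rewrite leqNgt; apply/negP=> dS.
have [A AF /setIidPr SA] := shatteredP _ _ FS _ (subxx S).
have defA : S = A by apply/eqP; rewrite eqEcard SA Fd.
by have := Fns S; rewrite FS defA => /(_ AF).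
Qed.

(** Families on any ground set count, which makes it possible to build them on
    a disjoint sum instead of an initial segment of the integers. *)
Lemma card_le_M (T : finType) d (F : {set {set T}}) :
  (forall A, A \in F -> #|A| = d.+1) -> VCdim F <= d -> #|F| <= M d #|T|.
Proof.
move=> Fd VCF; pose f := @enum_rank T.
have f_inj : injective f := enum_rank_inj.
have fK (S : {set 'I_#|T|}) : f @: (f @^-1: S) = S.
  apply/setP=> i; apply/imsetP/idP => [[x + ->] | Si]; first by rewrite inE.
  by exists (enum_val i); rewrite ?inE /f enum_valK.
have <- : #|[set f @: A | A : {set T} in F]| = #|F|.
  by rewrite card_imset //; apply: imset_inj.
apply: (bigmax_sup [set f @: A | A : {set T} in F]) => //.
apply/andP; split.
  by apply/subsetP=> _ /imsetP[A AF ->]; rewrite inE card_imset ?Fd.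
apply/bigmax_leqP=> S /shatteredP FS; rewrite -(fK S) card_imset //.
apply: leq_trans VCF; apply: (bigmax_sup (f @^-1: S)) => //.
apply/shatteredP=> B BS.
have [|_ /imsetP[A AF ->] AS] := FS (f @: B).
  by rewrite -(fK S) imsetS.
exists A => //; apply: (imset_inj f_inj); rewrite -AS -[in RHS](fK S).
by rewrite imsetI // => x y _ _; apply: f_inj.
Qed.

Lemma M_attained d n : exists F : {set {set 'I_n}},
  [/\ forall A, A \in F -> #|A| = d.+1, VCdim F <= d & #|F| = M d n].
Proof.
have [|F] := @eq_bigmax_cond _ (fun F : {set {set 'I_n}} =>
    (F \subset [set A : {set 'I_n} | #|A| == d.+1]) && (VCdim F <= d))
    (fun F => #|F|).
  apply/card_gt0P; exists set0; rewrite unfold_in sub0set /=.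
  by apply: VCdim_uniform => A; rewrite inE.
rewrite unfold_in => /andP[/subsetP Fd VCF] MF; exists F; split=> // A /Fd.
by rewrite inE => /eqP.
Qed.

(** * Counting by fibers *)

Lemma sum_card_fibers_le (T : finType) (I : eqType) (f : T -> I)
    (A : {set T}) (s : seq I) :
  uniq s -> \sum_(i <- s) #|[set x in A | f x == i]| <= #|A|.
Proof.
move=> s_uniq; rewrite -[leqRHS]sum1_card.
under eq_bigr => i _ do rewrite -sum1_card.
under eq_bigr => i _ do under eq_bigl => x do rewrite inE.
under eq_bigr => i _ do rewrite big_mkcondr.
rewrite exchange_big /=; apply: leq_sum => x _.
by rewrite -big_mkcond sum1_count /= (eq_count (eq_sym _)) count_uniq_mem ?leq_b1.
Qed.

(** * Patterns on five distinguished points *)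

Section Patterns.

Variable m : nat.
Implicit Types (X : {set 'I_5 + 'I_m}) (C D : {set 'I_m}) (s t : seq nat).

(** Patterns are increasing lists of numbers below 5 rather than sets of
    ordinals, so that statements about finitely many of them can be decided by
    computation. *)
Definition pattern X : seq nat :=
  [seq i <- iota 0 5 | inl (inord i) \in X].

Definition outer X : {set 'I_m} := inr @^-1: X.

Definition glue s C : {set 'I_5 + 'I_m} :=
  [set x | match x with inl i => val i \in s | inr y => y \in C end].

Lemma patternI X Y :
  pattern (X :&: Y) = [seq i <- pattern X | i \in pattern Y].
Proof.
rewrite /pattern -filter_predI; apply: eq_in_filter => i i5.
rewrite inE andbC -[RHS]/((i \in pattern Y) && (inl (inord i) \in X)).
by rewrite mem_filter i5 andbT.
Qed.

Lemma outerI X Y : outer (X :&: Y) = outer X :&: outer Y.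
Proof. exact: preimsetI. Qed.

Lemma pattern_glue s C : subseq s (iota 0 5) -> pattern (glue s C) = s.
Proof.
move=> s5; rewrite [RHS](subseq_uniqP (iota_uniq 0 5) s5).
apply: eq_in_filter => i; rewrite mem_iota => /andP[_ i5].
by rewrite inE /= inordK.
Qed.

Lemma outer_glue s C : outer (glue s C) = C.
Proof. by apply/setP=> y; rewrite !inE. Qed.

Lemma pattern_mem X (i : 'I_5) : (val i \in pattern X) = (inl i \in X).
Proof. by rewrite /pattern mem_filter mem_iota /= ltn_ord andbT inord_val. Qed.

Lemma glue_sub s C X :
  {subset s <= pattern X} -> C \subset outer X -> glue s C \subset X.
Proof.
move=> sX /subsetP CX; apply/subsetP=> -[i|y]; rewrite inE.
  by move/sX; rewrite pattern_mem.
by move/CX; rewrite inE.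
Qed.

Lemma card_pattern_outer X : #|X| = size (pattern X) + #|outer X|.
Proof.
rewrite -sum1_card big_sumType /=; congr (_ + _); last first.
  by rewrite -sum1_card; apply: eq_bigl => y; rewrite inE.
rewrite -sum1_size /pattern big_filter -[iota 0 5]/(index_iota 0 5) big_mkord.
by apply: eq_bigl => i; rewrite inord_val.
Qed.

Lemma card_glue s C : subseq s (iota 0 5) -> #|glue s C| = size s + #|C|.
Proof. by move=> s5; rewrite card_pattern_outer pattern_glue ?outer_glue. Qed.

Lemma glue_inj s : injective (glue s).
Proof. by move=> C D eqCD; rewrite -(outer_glue s C) eqCD outer_glue. Qed.

End Patterns.

(** * The admissible patterns *)

(** Without 4: the pivot 1, the edges of the path 0 - 1 - 2 - 3 and the larger
    subsets of {0, 1, 2, 3}.  With 4 removed from those containing it: the pivot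
    2, the edges of the path 1 - 2 - 3 - 0 and the larger subsets. *)
Definition core : seq (seq nat) :=
  [:: [:: 1];
      [:: 0; 1]; [:: 1; 2]; [:: 2; 3]; [:: 2; 4];
      [:: 0; 1; 2]; [:: 0; 1; 3]; [:: 0; 2; 3]; [:: 1; 2; 3];
      [:: 0; 3; 4]; [:: 1; 2; 4]; [:: 2; 3; 4];
      [:: 0; 1; 2; 3]; [:: 0; 1; 2; 4]; [:: 0; 1; 3; 4]; [:: 0; 2; 3; 4];
      [:: 1; 2; 3; 4];
      [:: 0; 1; 2; 3; 4]].

Definition extra : seq nat := [:: 1; 3; 4].

Definition meet (s t : seq nat) : seq nat := [seq i <- s | i \in t].

Definition missed (ps : seq (seq nat)) (t u : seq nat) : bool :=
  all (fun r : seq nat => meet r t != u) ps.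

(** The second alternative is there for t = {0, 2, 3}: no core
    pattern meets it in {3}, but {1, 3, 4} does. *)
Lemma core_missed t :
    t \in extra :: core ->
  exists2 u, subseq u t &
    missed [seq s <- extra :: core | size s <= size t] t u
    || (size t == 3) && missed core t u.
Proof.
pose good t u := subseq u t &&
  (missed [seq s <- extra :: core | size s <= size t] t u
   || (size t == 3) && missed core t u).
(* At most one point suffices for u, except on {0, 3, 4}, where all proper
   subsets other than {0, 4} are cut out by patterns of size at most 3. *)
pose candidates t := [:: [::], [:: 0; 4] & [seq [:: i] | i <- t]] : seq (seq nat).
suff: all (fun t => has (good t) (candidates t)) (extra :: core).
  by move=> /allP good_core /good_core/hasP[u _ /andP[]]; exists u.
by vm_compute.
Qed.

(** * The family *)

Section Construction.

Variables (m d : nat) (H : {set {set 'I_m}}).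

Definition family : {set {set 'I_5 + 'I_m}} :=
  [set X : {set 'I_5 + 'I_m} | (#|X| == d.+4) &&
    ((pattern X \in core) || (pattern X == extra) && (outer X \in H))].

Lemma VCdim_family : VCdim H <= d -> VCdim family <= d.+3.
Proof.
move=> VCH; apply: VCdim_uniform => [X | S]; rewrite inE;
  move=> /andP[/eqP cardS coreS] //.
have ptS : pattern S \in extra :: core.
  by rewrite inE; case/orP: coreS => [->|/andP[->]]; rewrite ?orbT.
have subS : subseq (pattern S) (iota 0 5) := filter_subseq _ _.
have [u uS /orP[missu | /andP[/eqP sz3 missu]]] := core_missed ptS.
  (* The trace [u] with the full outer part: only patterns no larger than that
     of [S] leave room for [outer S]. *)
  apply/shatteredP=> shS; have [|X FX XS] := shS (glue u (outer S)).
    by apply: glue_sub (mem_subseq uS) _.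
  move: FX; rewrite inE => /andP[/eqP cardX coreX].
  have ptX : pattern X \in extra :: core.
    by rewrite inE; case/orP: coreX => [->|/andP[->]]; rewrite ?orbT.
  have ux : meet (pattern X) (pattern S) = u.
    by rewrite /meet -patternI XS pattern_glue ?(subseq_trans uS).
  have oX : outer S \subset outer X.
    by apply/setIidPr; rewrite -outerI XS outer_glue.
  have szX : size (pattern X) <= size (pattern S).
    have := subset_leq_card oX; move: cardX cardS; rewrite !card_pattern_outer.
    lia.
  have /allP/(_ (pattern X)) := missu.
  by rewrite mem_filter szX ptX ux eqxx => /(_ isT).
(* The trace [u] with a part of [outer S] that [H] misses. *)
have cardO : #|outer S| = d.+1 by move: cardS; rewrite card_pattern_outer sz3; lia.
have [D DS missD] := missed_trace VCH (eq_leq (esym cardO)).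
apply/shatteredP=> shS; have [|X FX XS] := shS (glue u D).
  by apply: glue_sub (mem_subseq uS) _.
have ux : meet (pattern X) (pattern S) = u.
  by rewrite /meet -patternI XS pattern_glue ?(subseq_trans uS).
have oX : outer X :&: outer S = D.
  by rewrite -outerI XS outer_glue.
move: FX; rewrite inE => /andP[_ /orP[coreX | /andP[_ /missD//]]].
by have /allP/(_ _ coreX) := missu; rewrite ux eqxx.
Qed.

(** The coefficients count the core patterns of sizes 1, ..., 5; the guard
    excludes the full pattern, of size 5, when members have only 4 points. *)
Lemma card_family :
    (forall C, C \in H -> #|C| = d.+1) ->
  'C(m, d.+3) + 4 * 'C(m, d.+2) + 7 * 'C(m, d.+1) + 5 * 'C(m, d)
    + (0 < d) * 'C(m, d.-1) + #|H| <= #|family|.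
Proof.
move=> Hd; have uniq_pats : uniq (extra :: core) by [].
apply: leq_trans (sum_card_fibers_le (@pattern m) family uniq_pats).
have fiber s : s \in core ->
    (size s <= d.+4) * 'C(m, d.+4 - size s)
      <= #|[set X in family | pattern X == s]|.
  move=> cs; have [sd | //] := leqP (size s) d.+4.
  rewrite mul1n -[m in 'C(m, _)]card_ord -card_draws.
  have all5 : all (fun s => subseq s (iota 0 5)) core by [].
  have s5 : subseq s (iota 0 5) := allP all5 s cs.
  rewrite -(card_imset _ (@glue_inj m s)); apply/subset_leq_card/subsetP.
  move=> _ /imsetP[C + ->]; rewrite inE => /eqP cardC.
  rewrite inE [_ \in family]inE card_glue // pattern_glue // cs eqxx andbT.
  by rewrite cardC subnKC // eqxx.
have fiber_extra : #|H| <= #|[set X in family | pattern X == extra]|.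
  have s5 : subseq extra (iota 0 5) by [].
  rewrite -(card_imset _ (@glue_inj m extra)); apply/subset_leq_card/subsetP.
  move=> _ /imsetP[C HC ->].
  rewrite inE [_ \in family]inE card_glue // pattern_glue // outer_glue.
  by rewrite HC Hd // eqxx orbT !andbT.
rewrite big_cons addnC leq_add //.
have -> : 'C(m, d.+3) + 4 * 'C(m, d.+2) + 7 * 'C(m, d.+1) + 5 * 'C(m, d)
    + (0 < d) * 'C(m, d.-1)
    = \sum_(s <- core) (size s <= d.+4) * 'C(m, d.+4 - size s).
  rewrite /core !big_cons big_nil /= !mul1n
    !subSS !subn0 subn1; lia.
by rewrite [leqLHS]big_seq [leqRHS]big_seq; apply: leq_sum.
Qed.

End Construction.

(** Pascal's rule, four times on the first term and once on the second. *)
Lemma binomial_count m d :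
  'C(m.+4, d.+3) + 'C(m.+1, d.+1) =
  'C(m, d.+3) + 4 * 'C(m, d.+2) + 7 * 'C(m, d.+1) + 5 * 'C(m, d)
    + (0 < d) * 'C(m, d.-1).
Proof. by case: d => [|d]; rewrite !binS ?bin0 /=; lia. Qed.

Theorem theorem1p1 (d n : nat) (hd : 3 <= d) (hn : d + 3 <= n) :
  'C(n - 1, d) + 'C(n - 4, d - 2) + M (d - 3) (n - 5) <= M d n.
Proof.
have [e de] : exists e, d = e.+3 by exists (d - 3); lia.
have [m nm] : exists m, n = 5 + m by exists (n - 5); lia.
have [-> -> -> -> ->] :
    [/\ n - 1 = m.+4, n - 4 = m.+1, d - 2 = e.+1, d - 3 = e & n - 5 = m].
  by split; lia.
have [H [He VCH cardH]] := M_attained e m.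
rewrite de -cardH nm.
have Fe X : X \in family e H -> #|X| = e.+4.
  by rewrite inE => /andP[/eqP].
have := card_le_M Fe (VCdim_family VCH); rewrite card_sum !card_ord.
by apply/leq_trans/(leq_trans _ (card_family He)); rewrite binomial_count.
Qed.
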